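(* Consider the grey wolf optimizer with $T$ iterations under the stagnation assumption, and let $h_{ij}(\cdot,t)$ be the probability density function of $x_{ij}(t)$. For every integer $t$ with $2\le t\le T$, $h_{ij}(\cdot,t)$ is a single-peak function symmetric about $u_j=\frac13\sum p_j=\frac13(p_{1j}+p_{2j}+p_{3j})$; that is, its graph is symmetric about $u_j=\frac13\sum p_j$ and it is non-decreasing on $\bigl(-\infty,\frac13\sum p_j\bigr)$.
   Context: Setting: the GWO process for agent $i$ and coordinate $j$ under the stagnation assumption, i.e. the coordinates $p_{1j},p_{2j},p_{3j}\in\mathbb{R}$ of the three best search agents do not change with $t$. The initial value $x_{ij}(1)$ is uniformly distributed on the feasible interval $[l_j,r_j]$, $l_j<r_j$, and for $1\le t<T$ $$x_{ij}(t+1)=\tfrac13\sum_{k=1}^3p_{kj}+\tfrac13\sum_{k=1}^3A_{kj}(t)\,|C_{kj}(t)p_{kj}-x_{ij}(t)|,$$ where $A_{kj}(t)\sim U[-a(t),a(t)]$, $C_{kj}(t)\sim U[0,2]$, $a(t)=2(1-t/T)$, and all variables $A_{kj}(t),C_{kj}(t)$ (over all $k,t$) are independent of each other and of $x_{ij}(1)$. $U[p,q]$ is the uniform distribution on $[p,q]$. Densities are understood up to equality almost everywhere: pointwise assertions mean that a suitable version of the density has the property. *)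

(* Defs.v *)
From mathcomp Require Export all_boot all_order all_algebra.
From mathcomp Require Export all_classical all_reals all_analysis.

Set Implicit Arguments.
Unset Strict Implicit.
Unset Printing Implicit Defensive.

Import Order.TTheory GRing.Theory Num.Theory.
Import numFieldNormedType.Exports.

Local Open Scope classical_set_scope.
Local Open Scope ring_scope.

(* Mutual independence of the subfamily of [X] indexed by [D]: the product
   rule for every finite set of distinct indices in [D]. *)
Definition mutually_independent (d : measure_display) (Omega : measurableType d)
    (R : realType) (P : probability Omega R) (I : choiceType) (D : set I)
    (X : I -> {RV P >-> R}) : Prop :=
  forall (s : seq I) (E : I -> set R),
    uniq s -> (forall i, i \in s -> D i) ->
    (forall i, i \in s -> measurable (E i)) ->
    (P (\bigcap_(i in [set` s]) (X i @^-1` E i)) =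
     \prod_(i <- s) P (X i @^-1` E i))%E.

Definition has_uniform_law (d : measure_display) (Omega : measurableType d)
    (R : realType) (P : probability Omega R) (X : {RV P >-> R}) (p q : R) : Prop :=
  exists pq : p < q, forall B : set R, measurable B ->
    distribution P X B = uniform_prob pq B.

Definition is_pdf (d : measure_display) (Omega : measurableType d)
    (R : realType) (P : probability Omega R) (X : {RV P >-> R}) (h : R -> R) : Prop :=
  [/\ measurable_fun setT h,
      forall x, 0 <= h x &
      forall B : set R, measurable B ->
        distribution P X B = (\int[lebesgue_measure]_(x in B) (h x)%:E)%E].

Definition single_peak_about (R : realType) (u : R) (h : R -> R) : Prop :=
  (forall y, h (u + y) = h (u - y)) /\
  {in `]-oo, u[ &, {homo h : x y / x <= y}}.

(* The basic random inputs as one family: [None] stands for the initial value,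
   [Some (inl (t, k))] for A_k(t) and [Some (inr (t, k))] for C_k(t). *)
Definition gwo_inputs (d : measure_display) (Omega : measurableType d)
    (R : realType) (P : probability Omega R) (x1 : {RV P >-> R})
    (A C : nat -> 'I_3 -> {RV P >-> R})
    (i : option (nat * 'I_3 + nat * 'I_3)) : {RV P >-> R} :=
  match i with
  | None => x1
  | Some (inl (t, k)) => A t k
  | Some (inr (t, k)) => C t k
  end.

Definition gwo_index (T : nat) : set (option (nat * 'I_3 + nat * 'I_3)) :=
  [set i | match i with
           | None => True
           | Some (inl (t, _)) | Some (inr (t, _)) => (1 <= t < T)%N
           end].

Definition gwo_a (R : realType) (T t : nat) : R := 2 * (1 - t%:R / T%:R).

(* One coordinate of one agent under stagnation: [p k] is that coordinate of the
   k-th best agent, constant in time.  Only [x t] for [1 <= t <= T] and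
   [A t k], [C t k] for [1 <= t < T] are constrained. *)
Record gwo_process (d : measure_display) (Omega : measurableType d)
    (R : realType) (P : probability Omega R) (T : nat) (l r : R)
    (p : 'I_3 -> R) (A C : nat -> 'I_3 -> {RV P >-> R})
    (x : nat -> {RV P >-> R}) : Prop := GwoProcess {
  gwo_init : has_uniform_law (x 1%N) l r;
  gwo_A_law : forall t k, (1 <= t < T)%N ->
    has_uniform_law (A t k) (- gwo_a R T t) (gwo_a R T t);
  gwo_C_law : forall t k, (1 <= t < T)%N -> has_uniform_law (C t k) 0 2;
  gwo_indep : mutually_independent (gwo_index T) (gwo_inputs (x 1%N) A C);
  gwo_step : forall t, (1 <= t < T)%N -> forall w : Omega,
    x t.+1 w = 3^-1 * (\sum_(k < 3) p k)
             + 3^-1 * (\sum_(k < 3) A t k w * `|C t k w * p k - x t w|) }.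

(* Main.v *)
From HB Require Import structures.
Require Import Defs.
From mathcomp Require Import measurable_realfun ring lra zify.

Set Implicit Arguments.
Unset Strict Implicit.
Unset Printing Implicit Defensive.

Import Order.TTheory GRing.Theory Num.Theory.
Import numFieldNormedType.Exports.

Local Open Scope classical_set_scope.
Local Open Scope ring_scope.

(** Let u be the mean of the three p_k.  One step of the process reads
    x_{s+1} - u = c_0 A_0 + c_1 A_1 + c_2 A_2 with c_k = |C_k p_k - x_s| / 3,
    where the A_k are uniform on [-a, a], independent of each other and of
    (c_0, c_1, c_2).  Given the c_k, the law of this sum is a convolution of
    centred uniform laws, whose density is even and decreases away from 0: the
    density of c_2 A_2 is (a multiple of) the indicator of a centred interval,
    and averaging a function of |y| that decreases in |y| over the translates
    y - c s, with s in [-a, a], keeps that property.  Averaging the conditional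
    densities over the c_k keeps it as well.

    Decreasing in |y| is the predicate [radially_nonincreasing].  Its stability
    under averaging is [radially_nonincreasing_smear], which rests on
    [radially_nonincreasing_window]: two windows of equal width are exchanged by
    the reflection about the midpoint of their centres.

    The conditional argument needs c_2 > 0 almost surely, as otherwise c_2 A_2
    has no density.  Since x_s and C_2 are independent, this follows once x_s
    has no atom ([gwo_gap_gt0]).  The absence of atoms is proved by induction:
    x_1 is uniform, and the step itself yields a density for x_{s+1}
    ([gwo_state_atomless]).

    Conditioning is expressed by integrating over an independent input first
    ([ge0_integral_independent_input]).  The inputs are revealed in the order
    x_1, C(1), A(1), C(2), A(2), and so on; each one is independent of the
    sigma-algebra generated by those that come before it, and c_0, c_1, c_2 are
    measurable for every sigma-algebra that occurs when A_2, A_1, A_0 are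
    integrated out in turn.  [gwo_step_density] combines these facts.

    The density obtained takes values in the extended reals, because the
    expectation of 1 / c_2 may be infinite; a function that decreases in |y| and
    has a finite integral can be infinite at y = 0 only, so the single point u is
    repaired in [radial_density_single_peak].  Any other density agrees with this
    version almost everywhere. *)

(** * Affine changes of variable *)

(** Both sides, once multiplied by |c|, are measures in A that agree on the
    half-open intervals. *)
Lemma lebesgue_measure_affine (R : realType) (k c : R) (A : set R) :
  c != 0 -> measurable A ->
  lebesgue_measure ((fun s : R => k + c * s) @^-1` A) =
  (`|c|^-1%:E * lebesgue_measure A)%E.
Proof.
move=> c0 mA.
pose phi (s : measurableTypeR R) : measurableTypeR R := k + c * s.
have mphi : measurable_fun setT phi.
  by apply: measurable_funD => //; exact: measurable_funM.
have nc0 : 0 < `|c| by rewrite normr_gt0.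
have [nu nuE] : exists nu : {measure set (measurableTypeR R) -> \bar R},
    forall X, nu X = (`|c|%:E * lebesgue_measure (phi @^-1` X))%E.
  by unshelve eexists (mscale (NngNum (ltW nc0)) (pushforward lebesgue_measure phi)).
have -> : lebesgue_measure A = nu A.
  apply: lebesgue_measure_unique => // _ [[a b]] _ <- /=.
  rewrite nuE lebesgue_measure_itv/= lte_fin.
  have [cp|cn|/eqP] := ltgtP c 0; last by rewrite (negbTE c0).
  - have -> : phi @^-1` `]a, b] = `[(b - k) / c, (a - k) / c[%classic.
      apply/seteqP; split => s /=; rewrite !in_itv /= ler_ndivrMr// ltr_ndivlMr//.
        by rewrite /phi => /andP[? ?]; apply/andP; split; lra.
      by rewrite /phi => /andP[? ?]; apply/andP; split; lra.
    rewrite lebesgue_measure_itv/= lte_fin.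
    have -> : ((b - k) / c < (a - k) / c) = (a < b).
      by rewrite ltr_nM2r ?invr_lt0// ltrD2r.
    case: ifPn => ab; rewrite ?mule0// -!EFinB -EFinM; congr EFin.
    by rewrite ltr0_norm//; field.
  - have -> : phi @^-1` `]a, b] = `](a - k) / c, (b - k) / c]%classic.
      apply/seteqP; split => s /=; rewrite !in_itv /= ltr_pdivrMr// ler_pdivlMr//.
        by rewrite /phi => /andP[? ?]; apply/andP; split; lra.
      by rewrite /phi => /andP[? ?]; apply/andP; split; lra.
    rewrite lebesgue_measure_itv/= lte_fin.
    have -> : ((a - k) / c < (b - k) / c) = (a < b).
      by rewrite ltr_pM2r ?invr_gt0// ltrD2r.
    case: ifPn => ab; rewrite ?mule0// -!EFinB -EFinM; congr EFin.
    by rewrite gtr0_norm//; field.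
by rewrite nuE muleA -EFinM mulVf ?mul1e// gt_eqF.
Qed.

Lemma ge0_integral_affine (R : realType) (k c : R) (f : R -> \bar R) :
  c != 0 -> measurable_fun setT f -> (forall y, 0 <= f y)%E ->
  (\int[lebesgue_measure]_s f (k + c * s)%R =
   `|c|^-1%:E * \int[lebesgue_measure]_y f y)%E.
Proof.
move=> c0 mf f0.
pose phi (s : measurableTypeR R) : measurableTypeR R := k + c * s.
have mphi : measurable_fun setT phi.
  by apply: measurable_funD => //; exact: measurable_funM.
have ic0 : 0 <= `|c|^-1 by rewrite invr_ge0.
rewrite -(@ge0_integral_mscale _ _ _ lebesgue_measure _ measurableT (NngNum ic0))//.
transitivity (\int[pushforward lebesgue_measure phi]_y f y)%E.
  by rewrite ge0_integral_pushforward.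
apply: eq_measure_integral => A mA _.
by rewrite /mscale/= /pushforward; exact: lebesgue_measure_affine.
Qed.

(** * Functions that decrease away from the origin *)

(** Evenness is included: two points with the same absolute value are compared in
    both directions. *)
Definition radially_nonincreasing (R : realType) (f : R -> \bar R) : Prop :=
  forall y z : R, `|y| <= `|z| -> (f z <= f y)%E.

Lemma radially_nonincreasing_norm (R : realType) (f : R -> \bar R) (y z : R) :
  radially_nonincreasing f -> `|y| = `|z| -> f y = f z.
Proof. by move=> rf yz; apply/le_anti/andP; split; apply: rf; rewrite yz. Qed.

Lemma ge0_integral_reflection (R : realType) (k : R) (D : set R) (f : R -> \bar R) :
  measurable D -> measurable_fun setT f -> (forall y, 0 <= f y)%E ->
  (\int[lebesgue_measure]_(v in (fun v => (k - v)%R) @^-1` D) f (k - v)%R =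
   \int[lebesgue_measure]_(v in D) f v)%E.
Proof.
move=> mD mf f0; rewrite integral_mkcond [RHS]integral_mkcond.
have m1 : -1 != 0 :> R by rewrite oppr_eq0 oner_eq0.
transitivity (\int[lebesgue_measure]_s (f \_ D) (k + -1 * s)%R)%E.
  apply: eq_integral => v _; rewrite /patch mulN1r.
  by congr (if _ then _ else _); apply/idP/idP; rewrite !inE.
rewrite ge0_integral_affine//; last 2 first.
- by apply/(measurable_restrictT _ mD); exact: measurable_funTS.
- by move=> y; rewrite /patch; case: ifP.
by rewrite normrN1 invr1 mul1e.
Qed.

(** Take 0 <= y <= z by evenness.  The two windows share I z `&` I y, and the
    reflection v |-> y + z - v maps I z `\` I y onto I y `\` I z.  Every v in
    the former lies to the right of the midpoint of y and z, so that the absolute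
    value of its image is at most |v|, where f is at least f v. *)
Lemma radially_nonincreasing_window (R : realType) (b : R) (f : R -> \bar R) :
  measurable_fun setT f -> (forall y, 0 <= f y)%E -> radially_nonincreasing f ->
  radially_nonincreasing
    (fun y => \int[lebesgue_measure]_(v in `[(y - b)%R, (y + b)%R]) f v)%E.
Proof.
move=> mf f0 rf.
have mfD (D : set R) : measurable_fun D f by exact: measurable_funTS.
pose W (y : R) := (\int[lebesgue_measure]_(v in `[(y - b)%R, (y + b)%R]) f v)%E.
have W_norm y : W y = W `|y|.
  have [//|yN] := ger0P y.
  rewrite /W -(@ge0_integral_reflection _ 0 `[- y - b, - y + b])//.
  have -> : (fun v : R => 0 - v) @^-1` `[- y - b, - y + b] = `[y - b, y + b]%classic.
    by apply/seteqP; split => v /=; rewrite !in_itv /= => /andP[? ?]; apply/andP; split; lra.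
  apply: eq_integral => v _; apply: radially_nonincreasing_norm => //.
  by rewrite sub0r normrN.
move=> y z; rewrite -/(W y) -/(W z) (W_norm y) (W_norm z).
move: `|y| `|z| (normr_ge0 y) => {}y {}z y0 yz.
pose I x : set R := `[x - b, x + b]%classic.
have mI x : measurable (I x) by exact: measurable_itv.
have split_W x x' : W x = (\int[lebesgue_measure]_(v in I x `&` I x') f v +
                           \int[lebesgue_measure]_(v in I x `\` I x') f v)%E.
  rewrite -ge0_integral_setU//=; last 4 first.
  - by apply: measurableI; exact: mI.
  - by apply: measurableD; exact: mI.
  - exact: mfD.
  - by apply/disj_setPS => v [[_ ?] []].
  by rewrite setUIDK.
rewrite (split_W z y) (split_W y z) setIC; apply: leeD2l.
rewrite -(@ge0_integral_reflection _ (y + z) (I y `\` I z))//; last by apply: measurableD; exact: mI.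
have -> : (fun v : R => y + z - v) @^-1` (I y `\` I z) = I z `\` I y.
  apply/seteqP; split => v /=; rewrite /I /= !in_itv /= => -[/andP[? ?] Nv].
  - by split; [apply/andP; split; lra|apply: contra_not Nv => /andP[? ?]; apply/andP; split; lra].
  - by split; [apply/andP; split; lra|apply: contra_not Nv => /andP[? ?]; apply/andP; split; lra].
(* what is left to compare is f v and f (y + z - v) on I z `\` I y *)
apply: ge0_le_integral => //.
- by apply: measurableD; exact: mI.
- exact: mfD.
- apply: measurable_funTS; apply: measurableT_comp => //.
  by apply: (@measurable_funB _ _ _ _ (cst (y + z)) id).
move=> v; rewrite /I /= !in_itv /= => -[/andP[zv vz] /negP].
rewrite negb_and -!ltNge => yv; apply: rf.
have yv' : y + b < v by case/orP: yv => // ?; lra.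
have v0 : 0 <= v by lra.
rewrite (ger0_norm v0) ler_norml; apply/andP; split; lra.
Qed.

(** * Averaging over centred uniform variables *)

Lemma ge0_integral_uniform_affine (R : realType) (a : R) (ha : - a < a) (k c : R)
    (g : R -> \bar R) :
  c != 0 -> measurable_fun setT g -> (forall y, 0 <= g y)%E ->
  (\int[uniform_prob ha]_s g (k + c * s)%R =
   ((2 * a * `|c|)^-1)%:E *
   \int[lebesgue_measure]_(v in `[(k - `|c| * a)%R, (k + `|c| * a)%R]) g v)%E.
Proof.
move=> c0 mg g0.
have a0 : 0 < a by lra.
have nc0 : 0 < `|c| by rewrite normr_gt0.
have mphi : measurable_fun setT (fun s : R => k + c * s).
  by apply: measurable_funD => //; exact: measurable_funM.
rewrite integral_uniform//; last exact: measurableT_comp.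
have -> : (a - - a)^-1 = (2 * a)^-1 by congr (_^-1); ring.
rewrite [(2 * a * `|c|)^-1]invfM EFinM -muleA; congr (_ * _)%E.
rewrite [in RHS]integral_mkcond -(@ge0_integral_affine _ k)//; last 2 first.
- by apply/(measurable_restrictT _ (measurable_itv _)); exact: measurable_funTS.
- by move=> y; rewrite /patch; case: ifP.
rewrite integral_mkcond; apply: eq_integral => s _; rewrite /patch.
congr (if _ then _ else _); rewrite !mem_setE !in_itv /= -ler_distlC -ler_norml.
by rewrite opprD addNKr normrN normrM ler_pM2l.
Qed.

(** For each parameter q, the convolution of F (q, _) with the law of c times a
    uniform variable on [-a, a].  The scale c is added to the parameters, so that
    the operation can be iterated and its joint measurability kept. *)
Definition smear (R : realType) (a : R) (ha : - a < a) (d : measure_display)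
    (T : measurableType d) (F : T * R -> \bar R) (z : T * R * R) : \bar R :=
  (\int[uniform_prob ha]_s F (z.1.1, (z.2 - z.1.2 * s)%R))%E.

Lemma smear_ge0 (R : realType) (a : R) (ha : - a < a) (d : measure_display)
    (T : measurableType d) (F : T * R -> \bar R) z :
  (forall q, 0 <= F q)%E -> (0 <= smear ha F z)%E.
Proof. by move=> F0; exact: integral_ge0. Qed.

Lemma measurable_smear (R : realType) (a : R) (ha : - a < a) (d : measure_display)
    (T : measurableType d) (F : T * R -> \bar R) :
  measurable_fun setT F -> (forall q, 0 <= F q)%E ->
  measurable_fun setT (smear ha F).
Proof.
move=> mF F0.
apply: (@measurable_fun_fubini_tonelli_F _ _ _ _ _ (uniform_prob ha)
  (fun w : (T * R * R) * R => F (w.1.1.1, w.1.2 - w.1.1.2 * w.2))) => //.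
apply: (measurableT_comp mF); apply: measurable_fun_pair => /=.
  exact: (measurableT_comp measurable_fst (measurableT_comp measurable_fst measurable_fst)).
apply: measurable_funB; first exact: (measurableT_comp measurable_snd measurable_fst).
apply: measurable_funM; last exact: measurable_snd.
exact: (measurableT_comp measurable_snd (measurableT_comp measurable_fst measurable_fst)).
Qed.

(** For c <> 0 the average is, up to a constant factor, the integral of F (q, _)
    over a window of half-width |c| a centred at y; for c = 0 it is F (q, y). *)
Lemma radially_nonincreasing_smear (R : realType) (a : R) (ha : - a < a)
    (d : measure_display) (T : measurableType d) (F : T * R -> \bar R) q :
  measurable_fun setT F -> (forall q, 0 <= F q)%E ->
  (forall q, radially_nonincreasing (fun y => F (q, y))) ->
  radially_nonincreasing (fun y => smear ha F (q, y)).
Proof.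
case: q => q c mF F0 rF y z yz; rewrite /smear /=.
have mFq : measurable_fun setT (fun y => F (q, y)) by exact: measurableT_comp.
have [->|c0] := eqVneq c 0.
  under eq_integral do rewrite mul0r subr0.
  under [leRHS]eq_integral do rewrite mul0r subr0.
  apply: ge0_le_integral => //.
  by move=> s _; exact: rF.
have E x : (\int[uniform_prob ha]_s F (q, (x - c * s)%R) =
   ((2 * a * `|c|)^-1)%:E *
   \int[lebesgue_measure]_(v in `[(x - `|c| * a)%R, (x + `|c| * a)%R]) F (q, v))%E.
  rewrite -normrN -(@ge0_integral_uniform_affine _ _ ha _ _ (fun v => F (q, v)))//.
    by apply: eq_integral => s _; rewrite mulNr.
  by rewrite oppr_eq0.
rewrite !E; apply: lee_wpmul2l; last first.
  exact: (@radially_nonincreasing_window _ (`|c| * a) (fun v => F (q, v))).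
rewrite lee_fin invr_ge0 mulr_ge0// mulr_ge0//; lra.
Qed.

(** The density of c times a uniform variable on [-a, a], at the point (c, y).
    It vanishes identically for c = 0, where no density exists, because the
    inverse of 0 is 0; this keeps it jointly measurable and radially
    nonincreasing for every c. *)
Definition uniform_kernel (R : realType) (a : R) (z : R * R) : \bar R :=
  (if `|z.2| <= z.1 * a then (2 * a * z.1)^-1 else 0)%:E.

Lemma uniform_kernel_ge0 (R : realType) (a : R) (ha : - a < a) z :
  (0 <= uniform_kernel a z)%E.
Proof.
rewrite /uniform_kernel; case: ifPn => // h.
have a0 : 0 < a by lra.
rewrite lee_fin invr_ge0 mulr_ge0//; first by rewrite mulr_ge0// ltW.
by rewrite -(pmulr_lge0 _ a0) (le_trans _ h).
Qed.

Lemma measurable_uniform_kernel (R : realType) (a : R) (ha : - a < a) :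
  measurable_fun setT (@uniform_kernel R a).
Proof.
(* a real power is known to be measurable, and agrees with the inverse on the
   region c >= 0 selected by the test *)
have -> : @uniform_kernel R a = (fun z : R * R =>
    (if `|z.2| <= z.1 * a then (2 * a * z.1) `^ (-1) else 0)%:E).
  apply/funext => -[c y]; rewrite /uniform_kernel /=; case: ifPn => // h.
  have a0 : 0 < a by lra.
  rewrite powR_inv1// mulr_ge0//; first by rewrite mulr_ge0// ltW.
  by rewrite -(pmulr_lge0 _ a0) (le_trans _ h).
apply/measurable_EFinP; apply: measurable_fun_ifT => //=.
  apply: measurable_fun_ler; first exact: measurableT_comp measurable_snd.
  by apply: measurable_funM => //; exact: measurable_fst.
apply: (measurableT_comp (measurable_powR _)).
by apply: measurable_funM => //; exact: measurable_fst.
Qed.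

Lemma radially_nonincreasing_uniform_kernel (R : realType) (a : R) (ha : - a < a) c :
  radially_nonincreasing (fun y => uniform_kernel a (c, y)).
Proof.
move=> y z yz; rewrite {1}/uniform_kernel /=; case: ifPn => [zc|_].
  by rewrite /uniform_kernel /= (le_trans yz zc).
exact: uniform_kernel_ge0.
Qed.

Lemma integral_uniform_kernel (R : realType) (a : R) (ha : - a < a) (z c : R)
    (B : set R) :
  0 < c -> measurable B ->
  (\int[uniform_prob ha]_s (\1_B (z + c * s)%R)%:E =
   \int[lebesgue_measure]_(y in B) uniform_kernel a (c, (y - z)%R))%E.
Proof.
move=> c0 mB.
rewrite (@ge0_integral_uniform_affine _ _ ha z c (fun y => (\1_B y)%:E)) ?gt_eqF//; last first.
  by apply/measurable_EFinP; exact: measurable_indic.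
have a0 : 0 < a by lra.
rewrite gtr0_norm// -ge0_integralZl//; last 2 first.
- by apply/measurable_funTS/measurable_EFinP; exact: measurable_indic.
- by rewrite lee_fin invr_ge0 mulr_ge0// ?mulr_ge0// ltW.
rewrite integral_mkcond [RHS]integral_mkcond; apply: eq_integral => y _.
rewrite /patch /uniform_kernel /= mem_setE in_itv /= -ler_distlC indicE distrC.
by case: ifPn => _; case: (y \in B); rewrite ?mule1 ?mule0.
Qed.

(** * Densities on the real line *)

(** If G were infinite at some y <> 0, it would be infinite on [-|y|, |y|] and its
    integral could not be at most 1.  Hence G is finite off 0, and composing it
    with [fine] changes the density at the point u only. *)
Lemma radial_density_single_peak (d : measure_display) (Omega : measurableType d)
    (R : realType) (P : probability Omega R) (X : {RV P >-> R}) (u : R)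
    (G : R -> \bar R) :
  measurable_fun setT G -> (forall y, 0 <= G y)%E -> radially_nonincreasing G ->
  (forall B, measurable B ->
    distribution P X B = (\int[lebesgue_measure]_(v in B) G (v - u)%R)%E) ->
  exists h, is_pdf X h /\ single_peak_about u h.
Proof.
move=> mG G0 rG XG.
have mGu : measurable_fun setT (fun v : R => G (v - u)).
  apply: (measurableT_comp mG).
  by apply: (@measurable_funB _ _ _ _ id (cst u)).
have Gfin y : y != 0 -> G y \is a fin_num.
  move=> y0; rewrite ge0_fin_numE// ltey; apply/negP => /eqP Gy.
  pose I : set R := `[u - `|y|, u + `|y|]%classic.
  have IG : (\int[lebesgue_measure]_(v in I) G (v - u)%R = +oo)%E.
    transitivity (\int[lebesgue_measure]_(v in I) cst +oo%E v)%E.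
      apply: eq_integral => v; rewrite /I mem_setE in_itv /= => /andP[? ?].
      apply/eqP; rewrite -leye_eq -Gy; apply: rG.
      by rewrite ler_norml; apply/andP; split; lra.
    rewrite integral_cst; last exact: measurable_itv.
    rewrite /= /I lebesgue_measure_itv /= lte_fin ltrD2l gtrN// ?normr_gt0//.
    by rewrite -EFinB gt0_mulye// lte_fin opprD addrACA subrr add0r opprK addr_gt0// normr_gt0.
  have : (distribution P X I <= 1)%E by apply: probability_le1; exact: measurable_itv.
  by rewrite XG ?IG//; exact: measurable_itv.
exists (fun v : R => fine (G (v - u))); split; last first.
  split=> [y|x y].
    congr fine; apply: radially_nonincreasing_norm => //.
    by rewrite addrAC subrr add0r addrAC subrr add0r normrN.
  rewrite !in_itv /= => xu yu xy; apply: fine_le.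
  - by apply: Gfin; lra.
  - by apply: Gfin; lra.
  - by apply: rG; rewrite !ler0_norm//; lra.
split.
- exact: measurableT_comp.
- by move=> v; exact: fine_ge0.
move=> B mB; rewrite XG//; apply: ge0_ae_eq_integral => //.
- exact: measurable_funTS.
- by apply/measurable_EFinP/measurable_funTS; exact: measurableT_comp.
- by move=> v _; rewrite lee_fin fine_ge0.
exists [set u]; split => //.
- exact: lebesgue_measure_set1.
move=> v /=; apply: contra_notP => /eqP vu _; by rewrite fineK// Gfin// subr_eq0.
Qed.

Lemma pdf_ae_unique (d : measure_display) (Omega : measurableType d)
    (R : realType) (P : probability Omega R) (X : {RV P >-> R}) (h h' : R -> R) :
  is_pdf X h -> is_pdf X h' -> ae_eq lebesgue_measure setT h h'.
Proof.
move=> [mh h0 Xh] [mh' h'0 Xh'].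
have : ae_eq lebesgue_measure setT (EFin \o h) (EFin \o h').
  apply: integral_ae_eq => //.
  - apply/integrableP; split; first exact/measurable_EFinP.
    under eq_integral => y _ do rewrite /= ger0_norm//.
    by rewrite -Xh// probability_setT ltry.
  - exact/measurable_EFinP.
  - by move=> E _ mE; rewrite -Xh// -Xh'.
by apply: filterS => y /= hh' _; have [] := hh' I.
Qed.

(** * Independence of an input from the sigma-algebra of the others *)

Definition cylinders (d : measure_display) (Omega : measurableType d)
    (R : realType) (P : probability Omega R) (I : choiceType)
    (X : I -> {RV P >-> R}) (J : set I) : set (set Omega) :=
  [set F | exists s (E : I -> set R), [/\ uniq s, forall i, i \in s -> J i,
    forall i, measurable (E i) & F = \bigcap_(i in [set` s]) (X i @^-1` E i)]].

Lemma cylinders_setT (d : measure_display) (Omega : measurableType d)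
    (R : realType) (P : probability Omega R) (I : choiceType)
    (X : I -> {RV P >-> R}) (J : set I) : cylinders X J setT.
Proof.
exists [::], (fun=> setT); split => //.
by rewrite set_nil bigcap_set0.
Qed.

Lemma cylinders_preimage (d : measure_display) (Omega : measurableType d)
    (R : realType) (P : probability Omega R) (I : choiceType)
    (X : I -> {RV P >-> R}) (J : set I) (i : I) (E : set R) :
  J i -> measurable E -> cylinders X J (X i @^-1` E).
Proof.
move=> Ji mE; exists [:: i], (fun=> E); split => //.
- by move=> j; rewrite inE => /eqP ->.
- by rewrite set_cons1 bigcap_set1.
Qed.

Lemma cylinders_setI (d : measure_display) (Omega : measurableType d)
    (R : realType) (P : probability Omega R) (I : choiceType)
    (X : I -> {RV P >-> R}) (J : set I) : setI_closed (cylinders X J).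
Proof.
move=> _ _ [s [E [us sJ mE ->]]] [s' [E' [us' sJ' mE' ->]]].
exists (undup (s ++ s')), (fun i => (if i \in s then E i else setT) `&`
                                    (if i \in s' then E' i else setT)).
split; first exact: undup_uniq.
- by move=> i; rewrite mem_undup mem_cat => /orP[/sJ|/sJ'].
- by move=> i; apply: measurableI; case: ifP.
apply/seteqP; split => [w [ws ws'] i _|w ww].
  by split; case: ifP => // ?; [exact: ws|exact: ws'].
split => i /= si.
  have : i \in undup (s ++ s') by rewrite mem_undup mem_cat si.
  by move=> /ww[]; rewrite /= si.
have : i \in undup (s ++ s') by rewrite mem_undup mem_cat si orbT.
by move=> /ww[_]; rewrite /= si.
Qed.

Lemma cylinders_measurable (d : measure_display) (Omega : measurableType d)
    (R : realType) (P : probability Omega R) (I : choiceType)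
    (X : I -> {RV P >-> R}) (J : set I) : cylinders X J `<=` measurable.
Proof.
move=> _ [s [E [_ _ mE ->]]].
rewrite bigcap_seq; apply: bigsetI_measurable => i _.
exact: measurable_funPTI.
Qed.

(** The finite measures F |-> P (X_i in E, F) and F |-> P (X_i in E) P (F) agree on
    the cylinders by the product rule for the indices i :: s, and the cylinders
    form a generating pi-system. *)
Lemma mutually_independent_generated (d : measure_display)
    (Omega : measurableType d) (R : realType) (P : probability Omega R)
    (I : choiceType) (X : I -> {RV P >-> R}) (D J : set I) (i : I)
    (F : set Omega) (E : set R) :
  mutually_independent D X -> J `<=` D -> D i -> ~ J i ->
  <<s cylinders X J >> F -> measurable E ->
  P (X i @^-1` E `&` F) = (P (X i @^-1` E) * P F)%E.
Proof.
move=> iX JD Di nJi sF mE.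
have mXE : measurable (X i @^-1` E) by exact: measurable_funPTI.
rewrite setIC.
have -> : P (F `&` X i @^-1` E) = mrestr P mXE F by [].
have PE0 : 0 <= fine (P (X i @^-1` E)) by exact: fine_ge0.
have -> : (P (X i @^-1` E) * P F)%E = mscale (NngNum PE0) P F.
  by rewrite /mscale /= fineK// fin_num_measure.
apply: (g_sigma_algebra_measure_unique (cylinders X J) _ (fun=> setT)) => //.
- exact: cylinders_measurable.
- by move=> _; exact: cylinders_setT.
- by rewrite bigcup_const.
- exact: cylinders_setI.
- move=> _ [s [E' [us sJ mE' ->]]].
  have nis : i \notin s by apply/negP => /sJ.
  rewrite /= /mrestr /mscale /= fineK ?fin_num_measure// setIC.
  (* the product rule wants one family of sets for the indices i :: s *)
  pose E'' j := if j == i then E else E' j.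
  have E''s j : j \in s -> E'' j = E' j.
    by move=> js; rewrite /E'' ifN//; apply: contraNneq nis => <-.
  have -> : X i @^-1` E `&` \bigcap_(j in [set` s]) (X j @^-1` E' j) =
      \bigcap_(j in [set` i :: s]) (X j @^-1` E'' j).
    rewrite !bigcap_seq big_cons {1}/E'' eqxx; congr (_ `&` _).
    by rewrite big_seq [RHS]big_seq; apply: eq_bigr => j js; rewrite E''s.
  rewrite iX//=; last 3 first.
  - by rewrite nis.
  - by move=> j; rewrite inE => /orP[/eqP->//|/sJ /JD].
  - by move=> j _; rewrite /E''; case: ifP.
  rewrite big_cons {1}/E'' eqxx; congr (_ * _)%E.
  rewrite iX//; last by move=> j /sJ /JD.
  by rewrite big_seq [RHS]big_seq; apply: eq_bigr => j js; rewrite E''s.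
- move=> _; rewrite /= /mrestr; rewrite (le_lt_trans (probability_le1 _ _)) ?ltry//; exact: measurableI.
Qed.

(** Independence says that the law of (X, W) is the product of the two laws, so
    Tonelli's theorem allows one to integrate over the values of X first. *)
Lemma ge0_integral_independent_pair (d d' : measure_display)
    (Omega : measurableType d) (R : realType) (P : probability Omega R)
    (V : measurableType d') (X : {RV P >-> R}) (W : Omega -> V)
    (phi : R * V -> \bar R) :
  measurable_fun setT W ->
  (forall E F, measurable E -> measurable F ->
    P (X @^-1` E `&` W @^-1` F) = (P (X @^-1` E) * P (W @^-1` F))%E) ->
  measurable_fun setT phi -> (forall z, 0 <= phi z)%E ->
  (\int[P]_w phi (X w, W w) =
   \int[P]_w \int[distribution P X]_a phi (a, W w))%E.
Proof.
move=> mW iXW mphi phi0.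
pose mW_mixin := isMeasurableFun.Build _ _ _ _ _ mW.
pose W' : {mfun Omega >-> V} := HB.pack W mW_mixin.
have mXW : measurable_fun setT (fun w => (X w, W w)).
  by apply: measurable_fun_pair.
transitivity (\int[pushforward P (fun w => (X w, W w))]_z phi z)%E.
  by rewrite ge0_integral_pushforward.
transitivity (\int[distribution P X \x distribution P W']_z phi z)%E.
  apply: eq_measure_integral => /= A mA _; apply/esym.
  exact: product_measure_unique.
rewrite fubini_tonelli2// ge0_integral_distribution//.
  exact: measurable_fun_fubini_tonelli_G.
by move=> v; exact: integral_ge0.
Qed.

(** * Integrating out one uniform input *)

Lemma measurable_generated (d : measure_display) (Omega : measurableType d)
    (R : realType) (P : probability Omega R) (I : choiceType)
    (X : I -> {RV P >-> R}) (J : set I) (i : I) :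
  J i ->
  measurable_fun setT (X i : g_sigma_algebraType (cylinders X J) -> R).
Proof.
move=> Ji _ B mB; rewrite setTI; apply: sub_sigma_algebra.
exact: cylinders_preimage.
Qed.

Lemma measurable_generated_id (d : measure_display) (Omega : measurableType d)
    (R : realType) (P : probability Omega R) (I : choiceType)
    (X : I -> {RV P >-> R}) (J : set I) :
  measurable_fun setT (id : Omega -> g_sigma_algebraType (cylinders X J)).
Proof.
move=> _ B mB; rewrite setTI preimage_id.
move: mB; apply: smallest_sub; first exact: sigma_algebra_measurable.
exact: cylinders_measurable.
Qed.

(** In the remaining lemmas a random point w plays two roles: as an element of
    Omega for P, and as an element of the type that carries the sigma-algebra
    generated by the inputs indexed by J.  Choosing W to be the identity between
    the two types turns measurability for that sigma-algebra into independence
    of X_i. *)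
Lemma ge0_integral_independent_input (d : measure_display)
    (Omega : measurableType d) (R : realType) (P : probability Omega R)
    (I : choiceType) (X : I -> {RV P >-> R}) (D J : set I) (i : I)
    (a : R) (ha : - a < a)
    (phi : R * g_sigma_algebraType (cylinders X J) -> \bar R) :
  mutually_independent D X -> J `<=` D -> D i -> ~ J i ->
  (forall B, measurable B -> distribution P (X i) B = uniform_prob ha B) ->
  measurable_fun setT phi -> (forall z, 0 <= phi z)%E ->
  (\int[P]_w phi (X i w, w) = \int[P]_w \int[uniform_prob ha]_s phi (s, w))%E.
Proof.
move=> iX JD Di nJi lawX mphi phi0.
rewrite (@ge0_integral_independent_pair _ _ _ _ P
  (g_sigma_algebraType (cylinders X J)) (X i) id phi)//.
- apply: eq_integral => w _.
  have mid : measurable_fun setT (id : measurableTypeR R -> R) by [].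
  have mphiw : measurable_fun setT (fun s : R => phi (s, w)).
    exact: (measurableT_comp mphi
      (pair2_measurable (w : g_sigma_algebraType (cylinders X J)))).
  (* R and measurableTypeR R carry the same sets under different displays; the
     image measure by the identity passes from one to the other *)
  transitivity (\int[pushforward (uniform_prob ha) (id : measurableTypeR R -> R)]_s
      phi (s, w))%E.
    by apply: eq_measure_integral => B mB _; exact: lawX.
  by rewrite ge0_integral_pushforward.
- exact: measurable_generated_id.
- by move=> E F mE mF; exact: mutually_independent_generated iX JD Di nJi mF mE.
Qed.

(** The conditional expectation of F (q, z - c X_i) given the inputs in J: the
    uniform input X_i is replaced by the average over its law. *)
Lemma ge0_integral_smear (d d' : measure_display)
    (Omega : measurableType d) (R : realType) (P : probability Omega R)
    (I : choiceType) (X : I -> {RV P >-> R}) (D J : set I) (i : I)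
    (a : R) (ha : - a < a) (T : measurableType d') (F : T * R -> \bar R)
    (q : g_sigma_algebraType (cylinders X J) -> T)
    (c z : g_sigma_algebraType (cylinders X J) -> R) :
  mutually_independent D X -> J `<=` D -> D i -> ~ J i ->
  (forall B, measurable B -> distribution P (X i) B = uniform_prob ha B) ->
  measurable_fun setT F -> (forall y, 0 <= F y)%E ->
  measurable_fun setT q -> measurable_fun setT c -> measurable_fun setT z ->
  (\int[P]_w F (q w, (z w - c w * X i w)%R) =
   \int[P]_w smear ha F ((q w, c w), z w))%E.
Proof.
move=> iX JD Di nJi lawX mF F0 mq mc mz.
pose phi (v : R * g_sigma_algebraType (cylinders X J)) :=
  F (q v.2, (z v.2 - c v.2 * v.1)%R).
have phi0 v : (0 <= phi v)%E by exact: F0.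
apply: (@ge0_integral_independent_input _ Omega R P I X D J i a ha phi) => //.
apply: (measurableT_comp mF); apply: measurable_fun_pair.
  exact: (measurableT_comp mq measurable_snd).
apply: measurable_funB; first exact: (measurableT_comp mz measurable_snd).
apply: measurable_funM; last exact: measurable_fst.
exact: (measurableT_comp mc measurable_snd).
Qed.

(** Given the inputs in J, the variable z + c X_i has the density
    y |-> [uniform_kernel] (c, y - z) as soon as c > 0; Tonelli's theorem moves
    the expectation inside the integral over B. *)
Lemma distribution_independent_affine (d : measure_display)
    (Omega : measurableType d) (R : realType) (P : probability Omega R)
    (I : choiceType) (X : I -> {RV P >-> R}) (D J : set I) (i : I)
    (a : R) (ha : - a < a)
    (c z : g_sigma_algebraType (cylinders X J) -> R) (B : set R) :
  mutually_independent D X -> J `<=` D -> D i -> ~ J i ->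
  (forall B, measurable B -> distribution P (X i) B = uniform_prob ha B) ->
  measurable_fun setT c -> measurable_fun setT z -> {ae P, forall w : Omega, 0 < c w} ->
  measurable B ->
  (P [set w : Omega | B (z w + c w * X i w)%R] =
   \int[lebesgue_measure]_(y in B)
     \int[P]_w uniform_kernel a (c w, (y - z w)%R))%E.
Proof.
move=> iX JD Di nJi lawX mc mz c0 mB.
pose V := g_sigma_algebraType (cylinders X J).
have mid : measurable_fun setT (id : Omega -> V) by exact: measurable_generated_id.
pose phi (v : R * V) : \bar R := (\1_B (z v.2 + c v.2 * v.1))%:E.
have mphi : measurable_fun setT phi.
  apply/measurable_EFinP; apply: measurableT_comp; first exact: measurable_indic.
  apply: measurable_funD; first exact: (measurableT_comp mz measurable_snd).
  apply: measurable_funM; last exact: measurable_fst.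
  exact: (measurableT_comp mc measurable_snd).
have phi0 v : (0 <= phi v)%E by rewrite lee_fin.
have mS : measurable [set w : Omega | B (z w + c w * X i w)].
  rewrite -[X in measurable X]setTI.
  have m : measurable_fun setT (fun w : Omega => z w + c w * X i w).
    apply: measurable_funD; first exact: (measurableT_comp mz mid).
    by apply: measurable_funM => //; exact: (measurableT_comp mc mid).
  exact: m.
pose psi (v : V * R) : \bar R := ((\1_B v.2)%:E * uniform_kernel a (c v.1, (v.2 - z v.1)%R))%E.
have mpsi : measurable_fun setT psi.
  apply: emeasurable_funM.
    apply/measurable_EFinP; apply: measurableT_comp; first exact: measurable_indic.
    exact: measurable_snd.
  apply: (measurableT_comp (measurable_uniform_kernel ha)).
  apply: measurable_fun_pair; first exact: (measurableT_comp mc measurable_fst).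
  by apply: measurable_funB; [exact: measurable_snd|exact: (measurableT_comp mz measurable_fst)].
have psi0 v : (0 <= psi v)%E.
  by apply: mule_ge0; [rewrite lee_fin|exact: uniform_kernel_ge0].
pose psi' (v : Omega * R) := psi (v.1 : V, v.2).
have mpsi' : measurable_fun setT psi'.
  apply: (measurableT_comp mpsi); apply: measurable_fun_pair.
    exact: (measurableT_comp mid measurable_fst).
  exact: measurable_snd.
rewrite -[X in P X]setIT -integral_indic//.
transitivity (\int[P]_w phi (X i w, (w : V)))%E.
  by apply: eq_integral => w _; rewrite /phi /= !indicE.
transitivity (\int[P]_w \int[uniform_prob ha]_s phi (s, (w : V)))%E.
  exact: (@ge0_integral_independent_input _ Omega R P I X D J i a ha phi).
transitivity (\int[P]_w \int[lebesgue_measure]_y psi' (w, y))%E.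
  apply: ge0_ae_eq_integral => //.
  - have mG : measurable_fun setT
        (fun v : V => \int[uniform_prob ha]_s phi (s, v))%E.
      exact: (measurable_fun_fubini_tonelli_G (m1 := uniform_prob ha)).
    exact: (measurableT_comp mG mid).
  - exact: (measurable_fun_fubini_tonelli_F (m2 := lebesgue_measure)).
  - by move=> w _; exact: integral_ge0.
  - by move=> w _; apply: integral_ge0 => y _; exact: psi0.
  move: c0; apply: filterS => w cw _; rewrite /phi /= integral_uniform_kernel//.
  rewrite integral_mkcond; apply: eq_integral => y _.
  by rewrite /psi' /psi /patch /= indicE; case: (y \in B); rewrite ?mul1e ?mul0e.
rewrite fubini_tonelli//= [RHS]integral_mkcond; apply: eq_integral => y _.
rewrite /patch; case: ifPn => yB.
  by apply: eq_integral => w _; rewrite /psi' /psi /= indicE yB mul1e.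
by apply: integral0_eq => w _; rewrite /psi' /psi /= indicE (negbTE yB) mul0e.
Qed.

(** * One step of the process *)

(** The order in which the inputs are revealed.  The A_k(t) come after the C_k(t)
    because the scales of A_k(t) in the step depend on every C_k(t). *)
Definition gwo_rank (i : option (nat * 'I_3 + nat * 'I_3)) : nat :=
  match i with
  | None => 0
  | Some (inr (t, k)) => 6 * t + k
  | Some (inl (t, k)) => 6 * t + 3 + k
  end.

Definition gwo_past (T n : nat) : set (option (nat * 'I_3 + nat * 'I_3)) :=
  [set i | gwo_index T i /\ (gwo_rank i < n)%N].

Lemma gwo_past_sub (T n : nat) : gwo_past T n `<=` gwo_index T.
Proof. by move=> i []. Qed.

Lemma gwo_pastN (T : nat) i : ~ gwo_past T (gwo_rank i) i.
Proof. by case; rewrite ltnn. Qed.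

(** The inputs of times before s, hence of rank below 6 s, determine x_s. *)
Lemma measurable_gwo_state (d : measure_display) (Omega : measurableType d)
    (R : realType) (P : probability Omega R) (T : nat) (l r : R)
    (p : 'I_3 -> R) (A C : nat -> 'I_3 -> {RV P >-> R})
    (x : nat -> {RV P >-> R}) (s n : nat) :
  gwo_process T l r p A C x -> (1 <= s <= T)%N -> (6 * s <= n)%N ->
  measurable_fun setT (x s :
    g_sigma_algebraType (cylinders (gwo_inputs (x 1%N) A C) (gwo_past T n)) -> R).
Proof.
move=> hx; elim: s => [//|s IHs] /andP[_ sT] sn.
have [s0|s0] := posnP s.
  have := @measurable_generated _ _ _ P _ (gwo_inputs (x 1%N) A C) (gwo_past T n) None.
  by rewrite s0; apply; split => //=; lia.
have hs : (1 <= s < T)%N by rewrite s0.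
have mx := IHs ltac:(lia) ltac:(lia).
have mA k := @measurable_generated _ _ _ P _ (gwo_inputs (x 1%N) A C)
  (gwo_past T n) (Some (inl (s, k))).
have mC k := @measurable_generated _ _ _ P _ (gwo_inputs (x 1%N) A C)
  (gwo_past T n) (Some (inr (s, k))).
have kA k : gwo_past T n (Some (inl (s, k))).
  by split => //=; have := ltn_ord k; lia.
have kC k : gwo_past T n (Some (inr (s, k))).
  by split => //=; have := ltn_ord k; lia.
have -> : (x s.+1 : Omega -> R) = (fun w => 3^-1 * (\sum_(k < 3) p k) +
    3^-1 * (\sum_(k < 3) A s k w * `|C s k w * p k - x s w|)).
  by apply/funext => w; exact: (gwo_step hx hs).
apply: measurable_funD => //; apply: measurable_funM => //.
apply: measurable_sum => k; apply: measurable_funM; first exact: (mA _ (kA k)).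
apply: measurableT_comp => //; apply: measurable_funB => //.
by apply: measurable_funM => //; exact: (mC _ (kC k)).
Qed.

(** Given C_k(s), which is independent of x_s, the event x_s = C_k(s) p_k has
    probability 0 because x_s has no atom. *)
Lemma gwo_gap_gt0 (d : measure_display) (Omega : measurableType d)
    (R : realType) (P : probability Omega R) (T : nat) (l r : R)
    (p : 'I_3 -> R) (A C : nat -> 'I_3 -> {RV P >-> R})
    (x : nat -> {RV P >-> R}) (s : nat) (k : 'I_3) :
  gwo_process T l r p A C x -> (1 <= s < T)%N ->
  (forall v, P (x s @^-1` [set v]) = 0%E) ->
  {ae P, forall w : Omega, 0 < 3^-1 * `|C s k w * p k - x s w|}.
Proof.
move=> hx hs xs0.
have mbad : measurable [set z : R * R | z.1 = z.2 * p k].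
  have m : measurable_fun setT (fun z : R * R => z.1 == z.2 * p k).
    apply: measurable_fun_eqr; first exact: measurable_fst.
    by apply: measurable_funM => //; exact: measurable_snd.
  rewrite (_ : [set z | _] = (fun z : R * R => z.1 == z.2 * p k) @^-1` [set true]); last first.
    by apply/seteqP; split => z /= /eqP.
  by rewrite -[X in measurable X]setTI; exact: m.
pose phi (z : R * R) : \bar R := (\1_[set z : R * R | z.1 = z.2 * p k] z)%:E.
have mphi : measurable_fun setT phi.
  by apply/measurable_EFinP; exact: measurable_indic.
have mXC : measurable_fun setT (fun w => (x s w, C s k w)).
  exact: measurable_fun_pair.
have mN : measurable [set w | x s w = C s k w * p k].
  by rewrite -[X in measurable X]setTI; exact: (mXC measurableT _ mbad).
have null : P [set w | x s w = C s k w * p k] = 0%E.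
  rewrite -[X in P X]setIT -integral_indic//.
  transitivity (\int[P]_w phi (x s w, C s k w))%E.
    by apply: eq_integral => w _; rewrite /phi !indicE.
  rewrite (@ge0_integral_independent_pair _ _ _ _ P _ (x s) (C s k) phi)//.
  - apply: integral0_eq => w _.
    transitivity (\int[distribution P (x s)]_v (\1_[set C s k w * p k] v)%:E)%E.
      by apply: eq_integral => v _; rewrite /phi !indicE.
    by rewrite integral_indic// setIT; exact: xs0.
  - move=> E F mE mF; rewrite setIC muleC.
    apply: (@mutually_independent_generated _ _ _ P _ (gwo_inputs (x 1%N) A C)
      (gwo_index T) (gwo_past T (6 * s)) (Some (inr (s, k)))) => //.
    + exact: gwo_indep hx.
    + exact: gwo_past_sub.
    + by case => _ /=; lia.
    + have mx := @measurable_gwo_state _ _ _ P T l r p A C x s (6 * s) hx.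
      by have := mx ltac:(lia) ltac:(lia) measurableT E mE; rewrite setTI.
  - by move=> z; rewrite lee_fin.
exists [set w | x s w = C s k w * p k]; split => //.
move=> w /=; apply: contra_notP => /eqP wN; rewrite mulr_gt0// normr_gt0 subr_eq0.
by rewrite eq_sym.
Qed.

Lemma sum_ord3 (R : realType) (f : 'I_3 -> R) :
  \sum_(k < 3) f k = f (@Ordinal 3 0 isT) + f (@Ordinal 3 1 isT) + f (@Ordinal 3 2 isT).
Proof.
rewrite !big_ord_recl big_ord0 addr0 addrA.
by congr (f _ + f _ + f _); exact: val_inj.
Qed.

(** G is the expectation of the conditional density of c_0 A_0 + c_1 A_1 + c_2 A_2
    given the c_k.  The kernel handles A_2, which therefore needs c_2 > 0; the two
    averages handle A_1 and A_0, whose scales may vanish.  The inputs A_2, A_1, A_0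
    are integrated out in decreasing order of rank, so that at each stage what is
    left depends only on inputs of smaller rank. *)
Lemma gwo_step_density (d : measure_display) (Omega : measurableType d)
    (R : realType) (P : probability Omega R) (T : nat) (l r : R)
    (p : 'I_3 -> R) (A C : nat -> 'I_3 -> {RV P >-> R})
    (x : nat -> {RV P >-> R}) (s : nat) :
  gwo_process T l r p A C x -> (1 <= s < T)%N ->
  (forall v, P (x s @^-1` [set v]) = 0%E) ->
  exists G : R -> \bar R, [/\ measurable_fun setT G, forall y, (0 <= G y)%E,
    radially_nonincreasing G &
    forall B, measurable B -> distribution P (x s.+1) B =
      (\int[lebesgue_measure]_(v in B) G (v - 3^-1 * \sum_(k < 3) p k)%R)%E].
Proof.
move=> hx hs xs0.
pose k0 := @Ordinal 3 0 isT; pose k1 := @Ordinal 3 1 isT; pose k2 := @Ordinal 3 2 isT.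
set u := 3^-1 * \sum_(k < 3) p k.
pose a : R := gwo_a R T s.
have [ha _] := gwo_A_law hx k0 hs.
have lawA k B : measurable B -> distribution P (A s k) B = uniform_prob ha B.
  have [ha' lawAk] := gwo_A_law hx k hs; rewrite (bool_irrelevance ha ha').
  exact: lawAk.
pose X := gwo_inputs (x 1%N) A C.
pose iA k : option (nat * 'I_3 + nat * 'I_3) := Some (inl (s, k)).
pose V n := g_sigma_algebraType (cylinders X (gwo_past T n)).
pose c k (w : Omega) : R := 3^-1 * `|C s k w * p k - x s w|.
have mA n (k : 'I_3) : (6 * s + 3 + k < n)%N -> measurable_fun setT (A s k : V n -> R).
  move=> kn; have := @measurable_generated _ _ _ P _ X (gwo_past T n) (iA k).
  exact.
have mc n k : (6 * s + 3 <= n)%N -> measurable_fun setT (c k : V n -> R).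
  move=> sn; apply: measurable_funM => //; apply: measurableT_comp => //.
  apply: measurable_funB; last by apply: (measurable_gwo_state hx); lia.
  apply: measurable_funM => //.
  have := @measurable_generated _ _ _ P _ X (gwo_past T n) (Some (inr (s, k))).
  by apply; split => //=; have := ltn_ord k; lia.
have mcO k : measurable_fun setT (c k).
  apply: measurable_funM => //; apply: measurableT_comp => //.
  by apply: measurable_funB => //; exact: measurable_funM.
pose K := @uniform_kernel R a.
have mK : measurable_fun setT K by exact: measurable_uniform_kernel.
have K0 z : (0 <= K z)%E by exact: uniform_kernel_ge0.
pose F := smear ha (smear ha K).
have mF : measurable_fun setT F.
  apply: measurable_smear; first exact: measurable_smear.
  by move=> z; exact: smear_ge0.
have F0 z : (0 <= F z)%E by apply: smear_ge0 => q; exact: smear_ge0.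
have rF q : radially_nonincreasing (fun y => F (q, y)).
  apply: radially_nonincreasing_smear; first exact: measurable_smear.
    by move=> z; exact: smear_ge0.
  move=> q'; apply: radially_nonincreasing_smear => // q''.
  exact: radially_nonincreasing_uniform_kernel.
pose Phi (v : Omega * R) := F (((c k2 v.1, c k1 v.1), c k0 v.1), v.2).
have mPhi : measurable_fun setT Phi.
  have mc1 k : measurable_fun setT (fun v : Omega * R => c k v.1).
    exact: (measurableT_comp (mcO k) measurable_fst).
  apply: (measurableT_comp mF); apply: measurable_fun_pair; last exact: measurable_snd.
  apply: measurable_fun_pair; last exact: mc1.
  by apply: measurable_fun_pair; exact: mc1.
exists (fun y => \int[P]_w Phi (w, y))%E; split.
- exact: (@measurable_fun_fubini_tonelli_G _ _ _ _ _ P Phi mPhi (fun v => F0 _)).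
- by move=> y; apply: integral_ge0 => w _; exact: F0.
- move=> y z yz; apply: (ge0_le_integral P measurableT).
  + by move=> w _; exact: F0.
  + exact: (measurableT_comp mPhi (pair2_measurable z)).
  + exact: (measurableT_comp mPhi (pair2_measurable y)).
  + by move=> w _; exact: rF.
move=> B mB.
have Dk k : gwo_index T (iA k) by [].
have Ek (k : 'I_3) : gwo_rank (iA k) = (6 * s + 3 + k)%N by [].
pose z2 (w : Omega) : R := u + c k0 w * A s k0 w + c k1 w * A s k1 w.
transitivity (P [set w : Omega | B (z2 w + c k2 w * A s k2 w)]).
  rewrite /distribution /pushforward; congr (P _).
  have E w : x s.+1 w = z2 w + c k2 w * A s k2 w.
    rewrite (gwo_step hx hs) -/u sum_ord3 -/k0 -/k1 -/k2 /z2 /c; ring.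
  by apply/seteqP; split => w /=; rewrite E.
rewrite (@distribution_independent_affine _ _ _ P _ X (gwo_index T)
  (gwo_past T (gwo_rank (iA k2))) (iA k2) a ha (c k2) z2 B) //; first last.
- exact: gwo_gap_gt0 hx hs xs0.
- apply: measurable_funD; last first.
    by apply: measurable_funM; [apply: mc; rewrite Ek; lia|by apply: mA; rewrite !Ek ltn_add2l].
  apply: measurable_funD => //.
  by apply: measurable_funM; [apply: mc; rewrite Ek; lia|by apply: mA; rewrite !Ek ltn_add2l].
- by apply: mc; rewrite Ek; lia.
- exact: lawA.
- exact: gwo_pastN.
- exact: gwo_past_sub.
- exact: gwo_indep hx.
(* the density is now compared pointwise: A_1, then A_0, is averaged out *)
apply: eq_integral => y _.
transitivity (\int[P]_w K (c k2 w, ((y - u - c k0 w * A s k0 w) - c k1 w * A s k1 w)%R))%E.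
  by apply: eq_integral => w _; congr (K (_, _)); rewrite /z2; ring.
rewrite (@ge0_integral_smear _ _ _ _ P _ X (gwo_index T)
  (gwo_past T (gwo_rank (iA k1))) (iA k1) a ha _ K (c k2) (c k1)
  (fun w => y - u - c k0 w * A s k0 w))//; first last.
- apply: measurable_funB => //.
  by apply: measurable_funM; [apply: mc; rewrite Ek; lia|by apply: mA; rewrite !Ek ltn_add2l].
- by apply: mc; rewrite Ek; lia.
- by apply: mc; rewrite Ek; lia.
- exact: lawA.
- exact: gwo_pastN.
- exact: gwo_past_sub.
- exact: gwo_indep hx.
rewrite (@ge0_integral_smear _ _ _ _ P _ X (gwo_index T)
  (gwo_past T (gwo_rank (iA k0))) (iA k0) a ha _ (smear ha K)
  (fun w => (c k2 w, c k1 w)) (c k0) (fun=> y - u))//; first last.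
- by apply: mc; rewrite Ek; lia.
- by apply: measurable_fun_pair; apply: mc; rewrite Ek; lia.
- by move=> q; exact: smear_ge0.
- exact: measurable_smear.
- exact: lawA.
- exact: gwo_pastN.
- exact: gwo_past_sub.
- exact: gwo_indep hx.
Qed.

(** Induction on s: the law of x_1 has a density, and if x_s has no atom then the
    step produces a density for x_{s+1}. *)
Lemma gwo_state_atomless (d : measure_display) (Omega : measurableType d)
    (R : realType) (P : probability Omega R) (T : nat) (l r : R)
    (p : 'I_3 -> R) (A C : nat -> 'I_3 -> {RV P >-> R})
    (x : nat -> {RV P >-> R}) (s : nat) :
  gwo_process T l r p A C x -> (1 <= s <= T)%N ->
  forall v, P (x s @^-1` [set v]) = 0%E.
Proof.
move=> hx; elim: s => [//|s IHs] /andP[_ sT] v.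
have [s0|s0] := posnP s.
  have [lr lawx] := gwo_init hx.
  transitivity (distribution P (x 1%N) [set v]); first by rewrite s0.
  rewrite lawx//; have /null_content_dominatesP := dominates_uniform_prob lr.
  by apply => //; exact: lebesgue_measure_set1.
have hs : (1 <= s < T)%N by rewrite s0.
have [G [mG G0 _ xG]] := gwo_step_density hx hs (IHs ltac:(lia)).
transitivity (distribution P (x s.+1) [set v]); first by [].
rewrite xG//; exact: integral_set1.
Qed.

Theorem proposition3p2 (d : measure_display) (Omega : measurableType d)
    (R : realType) (P : probability Omega R) (T : nat) (l r : R) (hlr : l < r)
    (p : 'I_3 -> R) (A C : nat -> 'I_3 -> {RV P >-> R})
    (x : nat -> {RV P >-> R}) (hx : gwo_process T l r p A C x)
    (t : nat) (ht : (2 <= t <= T)%N) :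
  (exists h : R -> R, is_pdf (x t) h) /\
  (forall h : R -> R, is_pdf (x t) h ->
    exists h' : R -> R,
      [/\ is_pdf (x t) h',
          ae_eq lebesgue_measure setT h h' &
          single_peak_about (3^-1 * \sum_(k < 3) p k) h']).
Proof.
case: t ht => // s ht.
have hs : (1 <= s < T)%N by lia.
have hs' : (1 <= s <= T)%N by lia.
have [G [mG G0 rG xG]] := gwo_step_density hx hs (gwo_state_atomless hx hs').
have [h' [pdfh' peakh']] := radial_density_single_peak mG G0 rG xG.
split; first by exists h'.
by move=> h pdfh; exists h'; split => //; exact: pdf_ae_unique pdfh pdfh'.
Qed.
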